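(* Let $\mathcal{G}$ be a groupoid, let $(\mathcal{N},p)$ be a group bundle over $\mathcal{G}^{(0)}$, and let $[L]$ be a $\mathcal{G}$-kernel with $\operatorname{Ext}(\mathcal{G},\mathcal{N})_{[L]}\neq\emptyset$. Then the map $$H^2(\mathcal{G},Z(\mathcal{N}))_L\times\operatorname{Ext}(\mathcal{G},\mathcal{N})_{[L]}\to\operatorname{Ext}(\mathcal{G},\mathcal{N})_{[L]},\qquad \left([\rho],[\mathcal{N}\times_{(L,\sigma)}\mathcal{G}]\right)\mapsto[\mathcal{N}\times_{(L,\sigma\cdot\rho)}\mathcal{G}]$$ (where $(\sigma\cdot\rho)(x,y)=\sigma(x,y)\rho(x,y)$) is a well-defined simply transitive action.
   Context: Groupoids are purely algebraic (no topology). A groupoid $\mathcal{G}$ has unit space $\mathcal{G}^{(0)}\subseteq\mathcal{G}$ and range and source maps $r,s:\mathcal{G}\to\mathcal{G}^{(0)}$; $xy$ is defined iff $s(x)=r(y)$; $\mathcal{G}^{(n)}$ is the set of $n$-tuples with $s(x_i)=r(x_{i+1})$. A group bundle over $\mathcal{G}^{(0)}$ is a set $\mathcal{N}$ with a map $p:\mathcal{N}\to\mathcal{G}^{(0)}$ such that every fibre $N_u:=p^{-1}(u)$ is a group; identifying the identity $1_u$ of $N_u$ with $u$, $\mathcal{N}$ is a groupoid over $\mathcal{G}^{(0)}$ with $r=s=p$. Extensions. A groupoid extension of $\mathcal{G}$ by $\mathcal{N}$ is a surjective groupoid homomorphism $j:\mathcal{E}\to\mathcal{G}$, where $\mathcal{E}$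 is a groupoid with unit space $\mathcal{G}^{(0)}$, $j$ is the identity on $\mathcal{G}^{(0)}$, and $\mathcal{N}=\ker(j):=\{e\in\mathcal{E}: j(e)\in\mathcal{G}^{(0)}\}$. Two extensions $j:\mathcal{E}\to\mathcal{G}$, $j':\mathcal{E}'\to\mathcal{G}$ are equivalent if there is a groupoid homomorphism $\phi:\mathcal{E}\to\mathcal{E}'$ with $\phi|_{\mathcal{N}}=\mathrm{id}$ and $j'\circ\phi=j$. $\operatorname{Ext}(\mathcal{G},\mathcal{N})$ is the set of equivalence classes. Factor systems. $C^1(\mathcal{G},\operatorname{Iso}(\mathcal{N}))$ is the set of families of group isomorphisms $L_x:N_{s(x)}\to N_{r(x)}$, $x\in\mathcal{G}$, with $L_u=\mathrm{id}_{N_u}$ for $u\in\mathcal{G}^{(0)}$. $C^2(\mathcal{G},\mathcal{N})$ is the set of maps $\sigma:\mathcal{G}^{(2)}\to\mathcal{N}$ with $\sigma(x,y)\in N_{r(x)}$ and $\sigma(x,s(x))=\sigma(r(x),x)=r(x)$. A factor system for $(\mathcal{G},\mathcal{N})$ is a pair $(L,\sigma)$ satisfying the twisted action condition $L_xL_y(n)=\sigma(x,y)L_{xy}(n)\sigma(x,y)^{-1}$ for all $(x,y)\in\mathcal{G}^{(2)}$, $n\in N_{s(y)}$, and the twisted cocycle condition $\sigma(x,y)\sigma(xy,z)=L_x(\sigma(y,z))\sigma(x,yz)$ for all $(x,y,z)\in\mathcal{G}^{(3)}$. $\mathcal{N}\times_{(L,\sigma)}\mathcal{G}$ is the groupoid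 extension with underlying set $\{(n,x)\in\mathcal{N}\times\mathcal{G}: p(n)=r(x)\}$, source $s(x)$, range $r(x)$ (identifying $u$ with $(u,u)$), product $(n,x)(m,y)=(nL_x(m)\sigma(x,y),xy)$, inverse $(n,x)^{-1}=(\sigma(x^{-1},x)^{-1}L_{x^{-1}}(n^{-1}),x^{-1})$, projection $j(n,x)=x$, and $\mathcal{N}$ identified with $\ker j$ via $n\mapsto(n,p(n))$. Every extension of $\mathcal{G}$ by $\mathcal{N}$ is equivalent to one of this form. Kernels. $C^1(\mathcal{G},\mathcal{N})$ is the group of maps $h:\mathcal{G}\to\mathcal{N}$ with $h(x)\in N_{r(x)}$ and $h(u)=u$ for $u\in\mathcal{G}^{(0)}$; put $(h.L)_x(n)=h(x)L_x(n)h(x)^{-1}$. $L\in C^1(\mathcal{G},\operatorname{Iso}(\mathcal{N}))$ is outer if there is $\sigma\in C^2(\mathcal{G},\mathcal{N})$ such that $(L,\sigma)$ satisfies the twisted action condition. On outer elements, $L\sim L'$ iff $L'=h.L$ for some $h\in C^1(\mathcal{G},\mathcal{N})$; the class $[L]$ is called a $\mathcal{G}$-kernel. $\operatorname{Ext}(\mathcal{G},\mathcal{N})_{[L]}$ is the set of classes in $\operatorname{Ext}(\mathcal{G},\mathcal{N})$ corresponding to $[L]$, i.e. those containing some $\mathcal{N}\times_{(L',\sigma')}\mathcal{G}$ with $(L',\sigma')$ a factor system and $L'\sim L$. Cohomology. $Z(\mathcal{N}):=\bigcup_{u}Z(N_u)$ is the bundle of centres; for outer $L$ the restrictions of the $L_x$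 satisfy $L_xL_y=L_{xy}$ on $Z(\mathcal{N})$. An $n$-cochain ($n\ge1$) is a map $h:\mathcal{G}^{(n)}\to Z(\mathcal{N})$ with $h(x_1,\dots,x_n)\in Z(N_{r(x_1)})$ which takes identity values whenever some $x_i$ is a unit. Multiplicatively, $d^1_L(h)(x,y)=L_x(h(y))h(xy)^{-1}h(x)$ and $d^2_L(\rho)(x,y,z)=L_x(\rho(y,z))\rho(xy,z)^{-1}\rho(x,yz)\rho(x,y)^{-1}$. $Z^2(\mathcal{G},Z(\mathcal{N}))_L=\ker d^2_L$, $B^2(\mathcal{G},Z(\mathcal{N}))_L=\operatorname{im}d^1_L$, and $H^2(\mathcal{G},Z(\mathcal{N}))_L=Z^2/B^2$ (a group under pointwise product). *)

(* Defs.v *)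
From HB Require Import structures.
From mathcomp Require Import all_boot all_algebra.
From mathcomp Require Import boolp.

Set Implicit Arguments.
Unset Strict Implicit.
Unset Printing Implicit Defensive.

Local Open Scope group_scope.

(* A groupoid with unit space U, presented by its sets of arrows
     G u v = { x | r(x) = u and s(x) = v },
   so that x y is defined for exactly the pairs with s(x) = r(y) and the
   condition s(x) = r(y) on G^(2) is enforced by typing. The unit space is
   identified with a set of arrows through gid. *)
Record groupoid (U : Type) := Groupoid {
  arrow :> U -> U -> Type;
  gid : forall u, arrow u u;
  gmul : forall {u v w}, arrow u v -> arrow v w -> arrow u w;
  ginv : forall {u v}, arrow u v -> arrow v u;
  gmulA : forall u v w t (x : arrow u v) (y : arrow v w) (z : arrow w t),
    gmul x (gmul y z) = gmul (gmul x y) z;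
  gmul1x : forall u v (x : arrow u v), gmul (gid u) x = x;
  gmulx1 : forall u v (x : arrow u v), gmul x (gid v) = x;
  gmulVx : forall u v (x : arrow u v), gmul (ginv x) x = gid v;
  gmulxV : forall u v (x : arrow u v), gmul x (ginv x) = gid u
}.

Arguments gid {U} g u.

(* Homomorphisms of groupoids over U which are the identity on units. *)
Record groupoid_hom (U : Type) (G H : groupoid U) := GroupoidHom {
  ghom : forall {u v}, G u v -> H u v;
  ghom1 : forall u, ghom (gid G u) = gid H u;
  ghomM : forall u v w (x : G u v) (y : G v w),
    ghom (gmul x y) = gmul (ghom x) (ghom y)
}.

(* A group bundle over U is given by its fibres N u = p^-1(u). *)

Section Extensions.
Variables (U : Type) (G : groupoid U) (N : U -> groupType).

(* An arrow of E lying over a unit 1_u of G is an element of E u u, so the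
   identification of the group bundle N with ker(j) amounts to an isomorphism
   ext_inc u of N u onto { e : E u u | j(e) = 1_u } for every u. *)
Record extension := Extension {
  ext_gpd :> groupoid U;
  ext_proj : groupoid_hom ext_gpd G;
  ext_proj_surj : forall u v (x : G u v), exists e, ghom ext_proj e = x;
  ext_inc : forall u, N u -> ext_gpd u u;
  ext_incM : forall u (n m : N u),
    ext_inc (n * m) = gmul (ext_inc n) (ext_inc m);
  ext_inc_inj : forall u, injective (@ext_inc u);
  ext_inc_ker : forall u (e : ext_gpd u u),
    ghom ext_proj e = gid G u <-> exists n, ext_inc n = e
}.

(* A homomorphism restricting to the identity of N is the identity on units,
   hence preserves r and s. *)
Definition equivalent (E E' : extension) : Prop :=
  exists phi : groupoid_hom E E',
    (forall u (n : N u), ghom phi (ext_inc E n) = ext_inc E' n) /\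
    (forall u v (e : E u v),
       ghom (ext_proj E') (ghom phi e) = ghom (ext_proj E) e).

Definition ext_class (E : extension) : extension -> Prop := equivalent E.

Definition Ext : Type :=
  {C : extension -> Prop | exists E, C = ext_class E}.

Lemma equivalent_refl E : equivalent E E.
Proof. by exists (@GroupoidHom U E E (fun u v e => e)
  (fun u => erefl) (fun u v w x y => erefl)). Qed.

(* C^1(G, Iso(N)) *)
Record iso_family := IsoFamily {
  iso_at : forall {u v}, G u v -> N v -> N u;
  iso_atM : forall u v (x : G u v), {morph iso_at x : n m / n * m};
  iso_at_bij : forall u v (x : G u v), bijective (iso_at x);
  iso_at1 : forall u (n : N u), iso_at (gid G u) n = n
}.

(* C^1(G, N) *)
Record cochain1 := Cochain1 {
  c1 : forall {u v}, G u v -> N u;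
  c1_unit : forall u, c1 (gid G u) = 1
}.

(* C^2(G, N) *)
Record cochain2 := Cochain2 {
  c2 : forall {u v w}, G u v -> G v w -> N u;
  c2_unitr : forall u v (x : G u v), c2 x (gid G v) = 1;
  c2_unitl : forall u v (x : G u v), c2 (gid G u) x = 1
}.

Definition twisted_action (L : iso_family) (sigma : cochain2) : Prop :=
  forall u v w (x : G u v) (y : G v w) (n : N w),
    iso_at L x (iso_at L y n) =
    c2 sigma x y * iso_at L (gmul x y) n * (c2 sigma x y)^-1.

Definition twisted_cocycle (L : iso_family) (sigma : cochain2) : Prop :=
  forall u v w t (x : G u v) (y : G v w) (z : G w t),
    c2 sigma x y * c2 sigma (gmul x y) z =
    iso_at L x (c2 sigma y z) * c2 sigma x (gmul y z).

(* The sigma such that (L, sigma) is a factor system for (G, N). *)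
Record factor_system (L : iso_family) := FactorSystem {
  fs_c2 : cochain2;
  fs_action : twisted_action L fs_c2;
  fs_cocycle : twisted_cocycle L fs_c2
}.

Definition outer (L : iso_family) : Prop :=
  exists sigma, twisted_action L sigma.

(* L ~ L', i.e. L' = h.L for some h in C^1(G, N) *)
Definition kernel_equiv (L L' : iso_family) : Prop :=
  exists h : cochain1, forall u v (x : G u v) (n : N v),
    iso_at L' x n = c1 h x * iso_at L x n * (c1 h x)^-1.

Lemma kernel_equiv_refl L : kernel_equiv L L.
Proof.
exists (@Cochain1 (fun u v x => 1) (fun u => erefl)) => u v x n /=.
by rewrite invg1 mul1g mulg1.
Qed.

Lemma iso_at_1 (L : iso_family) u v (x : G u v) : iso_at L x 1 = 1.
Proof.
by apply: (@mulgI _ (iso_at L x 1)); rewrite -iso_atM !mulg1.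
Qed.

Lemma iso_atV (L : iso_family) u v (x : G u v) n :
  iso_at L x n^-1 = (iso_at L x n)^-1.
Proof.
by apply: (@mulgI _ (iso_at L x n)); rewrite -iso_atM !mulgV iso_at_1.
Qed.

Section CrossedProduct.
Variables (L : iso_family) (sigma : factor_system L).
Local Notation "L_[ x ]" := (iso_at L x) (format "L_[ x ]").
Local Notation s := (c2 (fs_c2 sigma)).

Definition crossed_arrow (u v : U) : Type := (N u * G u v)%type.

Definition crossed_id u : crossed_arrow u u := (1, gid G u).

Definition crossed_mul u v w (a : crossed_arrow u v) (b : crossed_arrow v w) :
    crossed_arrow u w :=
  (a.1 * L_[a.2] b.1 * s a.2 b.2, gmul a.2 b.2).

Definition crossed_inv u v (a : crossed_arrow u v) : crossed_arrow v u :=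
  ((s (ginv a.2) a.2)^-1 * L_[ginv a.2] (a.1)^-1, ginv a.2).

Lemma crossed_mulA u v w t (a : crossed_arrow u v) (b : crossed_arrow v w)
    (c : crossed_arrow w t) :
  crossed_mul a (crossed_mul b c) = crossed_mul (crossed_mul a b) c.
Proof.
case: a b c => [n x] [m y] [k z]; rewrite /crossed_mul /=; congr pair.
  rewrite !iso_atM (fs_action sigma) -!mulgA -(fs_cocycle sigma).
  by rewrite mulKg.
exact: gmulA.
Qed.

Lemma crossed_mul1x u v (a : crossed_arrow u v) :
  crossed_mul (crossed_id u) a = a.
Proof.
by case: a => n x; rewrite /crossed_mul /= iso_at1 c2_unitl gmul1x mul1g mulg1.
Qed.

Lemma crossed_mulx1 u v (a : crossed_arrow u v) :
  crossed_mul a (crossed_id v) = a.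
Proof.
by case: a => n x; rewrite /crossed_mul /= iso_at_1 c2_unitr gmulx1 !mulg1.
Qed.

Lemma crossed_mulVx u v (a : crossed_arrow u v) :
  crossed_mul (crossed_inv a) a = crossed_id v.
Proof.
case: a => n x; rewrite /crossed_mul /crossed_inv /= gmulVx; congr pair.
by rewrite -mulgA iso_atV -!mulgA mulKg mulVg.
Qed.

Lemma crossed_mulxV u v (a : crossed_arrow u v) :
  crossed_mul a (crossed_inv a) = crossed_id u.
Proof.
case: a => n x; rewrite /crossed_mul /crossed_inv /= gmulxV; congr pair.
have e : s x (ginv x) = L_[x] (s (ginv x) x).
  have := fs_cocycle sigma x (ginv x) x.
  by rewrite gmulxV gmulVx c2_unitl c2_unitr !mulg1.
rewrite iso_atM (fs_action sigma) gmulxV iso_at1 e iso_atV.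
by rewrite -!mulgA mulVg mulg1 mulKg mulgV.
Qed.

Definition crossed_groupoid : groupoid U :=
  Groupoid crossed_mulA crossed_mul1x crossed_mulx1 crossed_mulVx crossed_mulxV.

Definition crossed_proj : groupoid_hom crossed_groupoid G :=
  @GroupoidHom U crossed_groupoid G (fun u v a => a.2)
    (fun u => erefl) (fun u v w x y => erefl).

Definition crossed_inc u (n : N u) : crossed_groupoid u u := (n, gid G u).

Lemma crossed_proj_surj u v (x : G u v) :
  exists e, ghom crossed_proj e = x.
Proof. by exists (1, x). Qed.

Lemma crossed_incM u (n m : N u) :
  crossed_inc (n * m) = gmul (crossed_inc n) (crossed_inc m).
Proof.
by rewrite /crossed_inc /= /crossed_mul /= iso_at1 c2_unitl mulg1 gmul1x.
Qed.

Lemma crossed_inc_inj u : injective (@crossed_inc u).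
Proof. by move=> n m []. Qed.

Lemma crossed_inc_ker u (e : crossed_groupoid u u) :
  ghom crossed_proj e = gid G u <-> exists n, crossed_inc n = e.
Proof.
by case: e => n x /=; split=> [->|[m []]]; first by exists n.
Qed.

(* N x_(L, sigma) G *)
Definition crossed_product : extension :=
  Extension crossed_proj_surj crossed_incM crossed_inc_inj crossed_inc_ker.

End CrossedProduct.

(* Ext(G, N)_[L]: the classes containing some N x_(L', sigma') G with L' ~ L. *)
Definition Ext_kernel (L : iso_family) : Type :=
  {c : Ext | exists (L' : iso_family) (sigma' : factor_system L'),
     kernel_equiv L L' /\ sval c (crossed_product sigma')}.

Definition class_of (E : extension) : Ext :=
  exist _ (ext_class E) (ex_intro _ E erefl).

Lemma crossed_class_kernel (L L' : iso_family) (LL' : kernel_equiv L L')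
    (sigma : factor_system L') :
  exists (L1 : iso_family) (sigma1 : factor_system L1), kernel_equiv L L1 /\
    sval (class_of (crossed_product sigma)) (crossed_product sigma1).
Proof. by exists L', sigma; split=> //; apply: equivalent_refl. Qed.

(* The class of N x_(L', sigma) G in Ext(G, N)_[L], for L' ~ L. *)
Definition crossed_class (L L' : iso_family) (LL' : kernel_equiv L L')
    (sigma : factor_system L') : Ext_kernel L :=
  exist _ (class_of (crossed_product sigma)) (crossed_class_kernel LL' sigma).

(* C^1(G, Z(N)) and C^2(G, Z(N)) consist of the cochains with central values. *)
Definition central1 (h : cochain1) : Prop :=
  forall u v (x : G u v) (n : N u), commute (c1 h x) n.

Definition central2 (rho : cochain2) : Prop :=
  forall u v w (x : G u v) (y : G v w) (n : N u), commute (c2 rho x y) n.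

Definition d1 (L : iso_family) (h : cochain1) u v w (x : G u v) (y : G v w) :
    N u :=
  iso_at L x (c1 h y) * (c1 h (gmul x y))^-1 * c1 h x.

Definition d2 (L : iso_family) (rho : cochain2) u v w t
    (x : G u v) (y : G v w) (z : G w t) : N u :=
  iso_at L x (c2 rho y z) * (c2 rho (gmul x y) z)^-1
    * c2 rho x (gmul y z) * (c2 rho x y)^-1.

(* Z^2(G, Z(N))_L *)
Record cocycle2 (L : iso_family) := Cocycle2 {
  z2 :> cochain2;
  z2_central : central2 z2;
  z2_d2 : forall u v w t (x : G u v) (y : G v w) (z : G w t),
    d2 L z2 x y z = 1
}.

Lemma iso_at_commute (L : iso_family) u v (x : G u v) (a : N v) :
  (forall n, commute a n) -> forall m, commute (iso_at L x a) m.
Proof.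
move=> ca m; have [g _ gK] := iso_at_bij L x.
by rewrite -[m]gK /commute -!iso_atM ca.
Qed.

(* For central rho, the condition d2 rho = 1 reads as the untwisted cocycle
   identity. *)
Lemma d2_eq1 (L : iso_family) (rho : cochain2) u v w t
    (x : G u v) (y : G v w) (z : G w t) : central2 rho ->
  d2 L rho x y z = 1 <->
  c2 rho x y * c2 rho (gmul x y) z =
  iso_at L x (c2 rho y z) * c2 rho x (gmul y z).
Proof.
move=> cr; rewrite /d2; set a := iso_at L x _; set b := c2 rho _ z.
set c := c2 rho x (gmul y z); set d := c2 rho x y.
have cb (m : N u) : b^-1 * m = m * b^-1.
  by apply: (@mulgI _ b); rewrite mulVKg mulgA [b * m]cr mulgK.
rewrite -[a * _ * c]mulgA cb mulgA -[_ * b^-1 * _]mulgA -invgM.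
by split=> [/divg1_eq ->|<-]; rewrite ?mulgV.
Qed.

Lemma cochain2_eq (r r' : cochain2) :
  (forall u v w (x : G u v) (y : G v w), c2 r x y = c2 r' x y) -> r = r'.
Proof.
case: r r' => [r r1 r2] [r' r1' r2'] /= e.
have {}e : r = r'.
  do 3 (apply: functional_extensionality_dep => ?).
  by apply/funext => x; apply/funext => y; apply: e.
by case: _ / e r1' r2' => r1' r2'; congr Cochain2; apply: Prop_irrelevance.
Qed.

Lemma cocycle2_eq (L : iso_family) (r r' : cocycle2 L) :
  (forall u v w (x : G u v) (y : G v w), c2 r x y = c2 r' x y) -> r = r'.
Proof.
case: r r' => [r r1 r2] [r' r1' r2'] /= /cochain2_eq e.
by case: _ / e r1' r2' => r1' r2'; congr Cocycle2; apply: Prop_irrelevance.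
Qed.

Program Definition cochain2_one : cochain2 :=
  @Cochain2 (fun u v w x y => 1) _ _.

(* sigma . rho *)
Program Definition cochain2_mul (sigma rho : cochain2) : cochain2 :=
  @Cochain2 (fun u v w x y => c2 sigma x y * c2 rho x y) _ _.
Next Obligation. by rewrite !c2_unitr mulg1. Qed.
Next Obligation. by rewrite !c2_unitl mulg1. Qed.

Program Definition cochain2_inv (rho : cochain2) : cochain2 :=
  @Cochain2 (fun u v w x y => (c2 rho x y)^-1) _ _.
Next Obligation. by rewrite c2_unitr invg1. Qed.
Next Obligation. by rewrite c2_unitl invg1. Qed.

Lemma central2_one : central2 cochain2_one.
Proof. by move=> u v w x y n; rewrite /commute /= mul1g mulg1. Qed.

Lemma central2_mul r r' : central2 r -> central2 r' ->
  central2 (cochain2_mul r r').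
Proof.
move=> cr cr' u v w x y n; rewrite /commute /= -mulgA [_ * n]cr'.
by rewrite !mulgA [_ * n]cr.
Qed.

Lemma central2_inv r : central2 r -> central2 (cochain2_inv r).
Proof.
move=> cr u v w x y n; rewrite /commute /=.
by apply: (@mulgI _ (c2 r x y)); rewrite mulVKg mulgA [_ * n]cr mulgK.
Qed.

Section Cocycles.
Variable L : iso_family.

Program Definition cocycle2_one : cocycle2 L :=
  @Cocycle2 L cochain2_one central2_one _.
Next Obligation. by rewrite /d2 /= iso_at_1 invg1 !mulg1. Qed.

Program Definition cocycle2_mul (r r' : cocycle2 L) : cocycle2 L :=
  @Cocycle2 L (cochain2_mul r r')
    (central2_mul (@z2_central _ r) (@z2_central _ r')) _.
Next Obligation.
apply/d2_eq1; first exact: central2_mul (@z2_central _ r) (@z2_central _ r').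
rewrite /= iso_atM.
have /d2_eq1 e := z2_d2 r x y z; have /d2_eq1 e' := z2_d2 r' x y z.
rewrite -mulgA [c2 r' x y * _]mulgA [c2 r' x y * _](@z2_central _ r').
rewrite -mulgA mulgA e ?e'; last exact: z2_central.
  rewrite -!mulgA; congr (_ * _); rewrite !mulgA; congr (_ * _).
  exact: (@z2_central _ r).
exact: z2_central.
Qed.

Program Definition cocycle2_inv (r : cocycle2 L) : cocycle2 L :=
  @Cocycle2 L (cochain2_inv r) (central2_inv (@z2_central _ r)) _.
Next Obligation.
apply/d2_eq1; first exact: central2_inv (@z2_central _ r).
have /d2_eq1 e := z2_d2 r x y z.
rewrite /= iso_atV -!invgM.
have -> : c2 r (gmul x y) z * c2 r x y = c2 r x y * c2 r (gmul x y) z.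
  exact: (@z2_central _ r).
rewrite e; last exact: z2_central.
congr (_^-1); exact/esym/(@z2_central _ r).
Qed.

HB.instance Definition _ := gen_eqMixin (cocycle2 L).
HB.instance Definition _ := gen_choiceMixin (cocycle2 L).

Lemma cocycle2_mulA : associative cocycle2_mul.
Proof. by move=> a b c; apply: cocycle2_eq => *; rewrite /= mulgA. Qed.

Lemma cocycle2_mulC : commutative cocycle2_mul.
Proof. by move=> a b; apply: cocycle2_eq => *; apply: z2_central. Qed.

Lemma cocycle2_mul1r : left_id cocycle2_one cocycle2_mul.
Proof. by move=> a; apply: cocycle2_eq => *; rewrite /= mul1g. Qed.

Lemma cocycle2_mulVr : left_inverse cocycle2_one cocycle2_inv cocycle2_mul.
Proof. by move=> a; apply: cocycle2_eq => *; rewrite /= mulVg. Qed.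

(* The pointwise product of cocycles is the additive law of a zmodType, as
   required by MathComp's quotients {quot _} of abelian groups. *)
HB.instance Definition _ := GRing.isZmodule.Build (cocycle2 L)
  cocycle2_mulA cocycle2_mulC cocycle2_mul1r cocycle2_mulVr.

(* B^2(G, Z(N))_L; for outer L every d^1_L(h) with h central is a cocycle. *)
Definition coboundary2 : {pred cocycle2 L} := fun rho : cocycle2 L =>
  `[< exists h : cochain1, central1 h /\
      forall u v w (x : G u v) (y : G v w), c2 rho x y = d1 L h x y >].

Lemma coboundary2_zmod_closed : zmod_closed coboundary2.
Proof.
split.
  apply/asboolP; exists (@Cochain1 (fun u v x => 1) (fun u => erefl)).
  split=> [u v x n|u v w x y]; first by rewrite /commute /= mul1g mulg1.
  by rewrite /d1 /= iso_at_1 invg1 !mulg1.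
move=> a b /asboolP[h [ch eh]] /asboolP[k [ck ek]]; apply/asboolP.
have ckV u v (x : G u v) (n : N u) : commute (c1 k x)^-1 n.
  by apply: (@mulgI _ (c1 k x)); rewrite mulVKg mulgA [_ * n]ck mulgK.
have e u : c1 h (gid G u) * (c1 k (gid G u))^-1 = 1.
  by rewrite !c1_unit mulgV.
exists (@Cochain1 (fun u v x => c1 h x * (c1 k x)^-1) e).
split=> [u v x n|u v w x y].
  by rewrite /commute /= -mulgA [_^-1 * n]ckV !mulgA [_ * n]ch.
rewrite (_ : c2 _ x y = c2 a x y * (c2 b x y)^-1) //.
rewrite eh ek /d1 /= iso_atM iso_atV.
rewrite !invgM !invgK.
set A := iso_at L x _; set B := c1 h (gmul x y); set C := c1 h x.
set A' := iso_at L x _; set B' := c1 k (gmul x y); set C' := c1 k x.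
have cA' (n : N u) : A'^-1 * n = n * A'^-1.
  apply: (@mulgI _ A'); rewrite mulVKg mulgA.
  have -> : A' * n = n * A' by apply: (iso_at_commute L x (ck _ _ _)).
  by rewrite mulgK.
rewrite -!mulgA; congr (_ * _); rewrite !mulgA -[LHS]cA' -!mulgA.
congr (_ * _); have cB' n : B' * n = n * B' by apply: ck.
by rewrite [RHS]cB' -!mulgA.
Qed.

HB.instance Definition _ :=
  GRing.isZmodClosed.Build (cocycle2 L) coboundary2 coboundary2_zmod_closed.

(* H^2(G, Z(N))_L = Z^2 / B^2, written additively *)
Definition H2 : zmodType := Quotient.quot coboundary2.

Definition H2_class (rho : cocycle2 L) : H2 :=
  \pi_(Quotient.quot coboundary2)%qT rho.

End Cocycles.

Section Twist.
Variables (L L' : iso_family) (LL' : kernel_equiv L L').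
Variables (sigma : factor_system L') (rho : cocycle2 L).

Lemma kernel_equiv_central u v (x : G u v) (a : N v) :
  (forall n, commute a n) -> iso_at L' x a = iso_at L x a.
Proof.
case: LL' => h -> ca.
by rewrite -mulgA (iso_at_commute L x ca) mulgA mulgV mul1g.
Qed.

Lemma twist_action : twisted_action L' (cochain2_mul (fs_c2 sigma) rho).
Proof.
move=> u v w x y n; rewrite (fs_action sigma) /= invgM.
set a := c2 _ x y; set r := c2 rho x y; set m := iso_at L' _ n.
rewrite -!mulgA; congr (_ * _).
by rewrite [RHS]mulgA [r * m](z2_central rho) -mulgA mulVKg.
Qed.

Lemma twist_cocycle : twisted_cocycle L' (cochain2_mul (fs_c2 sigma) rho).
Proof.
move=> u v w t x y z; rewrite /= iso_atM.
rewrite (@kernel_equiv_central _ _ x (c2 rho y z)) => [|n]; last first.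
  exact: z2_central.
have /d2_eq1 e := z2_d2 rho x y z; have e' := fs_cocycle sigma x y z.
rewrite -mulgA [c2 rho x y * _]mulgA [c2 rho x y * _]z2_central.
rewrite -mulgA mulgA e' e; last exact: z2_central.
rewrite -!mulgA; congr (_ * _); rewrite !mulgA; congr (_ * _).
by apply/esym/iso_at_commute => n; apply: z2_central.
Qed.

(* The factor system (L', sigma . rho). *)
Definition twist : factor_system L' := FactorSystem twist_action twist_cocycle.

End Twist.

End Extensions.

Definition is_action (A : zmodType) (X : Type) (act : A -> X -> X) : Prop :=
  (forall x, act 0%R x = x) /\
  (forall a b x, act (a + b)%R x = act a (act b x)).

Definition simply_transitive (A X : Type) (act : A -> X -> X) : Prop :=
  forall x y, exists! a, act a x = y.

(* Main.v *)
Require Import Defs.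
From mathcomp Require Import all_boot all_algebra.
From mathcomp Require Import boolp.

(** A homomorphism of extensions that fixes N and G sends (1, x) to (h(x), x)
    for some h in C^1(G, N), and is determined by h.  Writing out
    multiplicativity shows that N x_(L1, s1) G and N x_(L2, s2) G are
    equivalent exactly when some h satisfies
      L1_x(n) h(x) = h(x) L2_x(n)   and
      s1(x, y) h(xy) = h(x) L2_x(h(y)) s2(x, y),
    that is, when the two factor systems differ by the gauge transformation h
    (crossed_equivP).  Everything about Ext(G, N)_[L] is read off from this
    criterion.

    - Surjectivity of sigma |-> [N x_(L', sigma) G] for each fixed L' ~ L.  If
      L1 and L' both represent the kernel [L], the first equation holds for
      some h, and the second one can then be solved for s2.  The solution is
      automatically a factor system (gauge_transport), so that every class has
      a representative over L' (crossed_class_surj).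
    - The action is well defined.  If h carries s2 to s1 and k is a central
      cochain with r1 = d^1(k) r2, then h k carries s2 r2 to s1 r1, because the
      central factors can be moved freely and all L' ~ L have the same
      restriction to the centres (twist_equivalent).
    - The action is free.  A gauge transformation h from s r2 to s r1 over one
      and the same L commutes with the image of every L_x, hence is central;
      the second equation then says r1 = d^1(h) r2 (twist_free).
    - The action is transitive.  Both s1(x, y) and s2(x, y) conjugate L_xy into
      L_x L_y, so r = s1^-1 s2 is central, and dividing the two twisted cocycle
      identities shows that r is a cocycle (twist_transitive).

    Equality of classes is equivalence of extensions because an equivalence is
    automatically invertible, by the five lemma (equivalent_sym). *)

(** * Equivalence of extensions *)

Section Groupoids.
Local Set Implicit Arguments.
Local Unset Strict Implicit.

Lemma gmul_injr (U : Type) (G : groupoid U) u v w (x : G u v) (y z : G v w) :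
  gmul x y = gmul x z -> y = z.
Proof.
move=> /(congr1 (gmul (ginv x))).
by rewrite !gmulA !gmulVx !gmul1x.
Qed.

Lemma ghomV (U : Type) (G H : groupoid U) (f : groupoid_hom G H) u v
    (x : G u v) :
  ghom f (ginv x) = ginv (ghom f x).
Proof.
by apply: (@gmul_injr _ _ _ _ _ (ghom f x)); rewrite -ghomM !gmulxV ghom1.
Qed.

End Groupoids.

Section Extensions.
Local Set Implicit Arguments.
Local Unset Strict Implicit.
Local Open Scope group_scope.

Variables (U : Type) (G : groupoid U) (N : U -> groupType).
Implicit Types (E : extension G N) (L : iso_family G N) (h k : cochain1 G N).

Lemma ext_inc1 E u : ext_inc E (1 : N u) = gid E u.
Proof.
apply: (@gmul_injr _ _ _ _ _ (ext_inc E 1)).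
by rewrite -ext_incM mulg1 gmulx1.
Qed.

Lemma ext_proj_fiber E u v (e e' : E u v) :
  ghom (ext_proj E) e = ghom (ext_proj E) e' ->
  exists n, e' = gmul e (ext_inc E n).
Proof.
move=> ee'; have /ext_inc_ker[n ne] :
    ghom (ext_proj E) (gmul (ginv e) e') = gid G v.
  by rewrite ghomM ghomV ee' gmulVx.
by exists n; rewrite ne gmulA gmulxV gmul1x.
Qed.

Lemma equivalent_trans E1 E2 E3 :
  equivalent E1 E2 -> equivalent E2 E3 -> equivalent E1 E3.
Proof.
move=> [f [fN fG]] [g [gN gG]].
have gf1 u : ghom g (ghom f (gid E1 u)) = gid E3 u by rewrite !ghom1.
have gfM u v w (x : E1 u v) (y : E1 v w) : ghom g (ghom f (gmul x y)) =
    gmul (ghom g (ghom f x)) (ghom g (ghom f y)) by rewrite !ghomM.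
by exists (GroupoidHom gf1 gfM); split=> [u n|u v e] /=; rewrite ?fN ?gG.
Qed.

(** The five lemma: on each set of arrows an equivalence is injective and
    surjective, since it is the identity on both ker(j) and G. *)
Lemma equivalent_sym E1 E2 : equivalent E1 E2 -> equivalent E2 E1.
Proof.
move=> [f [fN fG]].
have f_inj u v (a b : E1 u v) : ghom f a = ghom f b -> a = b.
  move=> fab; have [|n bE] := @ext_proj_fiber E1 u v a b.
    by rewrite -!fG fab.
  have : gmul (ghom f a) (ext_inc E2 1) = gmul (ghom f a) (ext_inc E2 n).
    by rewrite ext_inc1 gmulx1 -fN -ghomM -bE.
  by rewrite bE => e; rewrite -(ext_inc_inj (gmul_injr e)) ext_inc1 gmulx1.
have f_surj u v (e : E2 u v) : {a : E1 u v | ghom f a = e}.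
  apply: cid; have [a aE] := ext_proj_surj E1 (ghom (ext_proj E2) e).
  have [|n ->] := @ext_proj_fiber E2 u v (ghom f a) e; first by rewrite fG.
  by exists (gmul a (ext_inc E1 n)); rewrite ghomM fN.
pose g u v e := sval (@f_surj u v e).
have gK u v e : ghom f (@g u v e) = e by rewrite /g; case: (f_surj u v e).
have g1 u : g u u (gid E2 u) = gid E1 u by apply: f_inj; rewrite gK ghom1.
have gM u v w (x : E2 u v) (y : E2 v w) :
  g u w (gmul x y) = gmul (g u v x) (g v w y).
  by apply: f_inj; rewrite ghomM !gK.
exists (GroupoidHom g1 gM); split=> [u n|u v e] /=.
  by apply: f_inj; rewrite gK fN.
by rewrite -fG gK.
Qed.

Lemma ext_class_eq E1 E2 : equivalent E1 E2 -> ext_class E1 = ext_class E2.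
Proof.
move=> E12; apply/funext => E; apply/propext; split.
  exact/equivalent_trans/equivalent_sym.
exact: equivalent_trans.
Qed.

Lemma crossed_class_eqP L L1 L2 (LL1 : kernel_equiv L L1)
    (LL2 : kernel_equiv L L2) (s1 : factor_system L1) (s2 : factor_system L2) :
  crossed_class LL1 s1 = crossed_class LL2 s2 <->
  equivalent (crossed_product s1) (crossed_product s2).
Proof.
split=> [s12|s12].
  (* Every class contains its own representative. *)
  have /= s12E := congr1 (fun c => sval (sval c) (crossed_product s2)) s12.
  by rewrite -[equivalent _ _]/(ext_class _ _) s12E; apply: equivalent_refl.
by do 2 apply: eq_exist; apply: ext_class_eq.
Qed.

(** * Gauge transformations of factor systems *)

(** The gauge transformation h carries (L2, s2) to (L1, s1).  The equations are
    written without inverses so that they can be multiplied together and used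
    for rewriting in both directions; the first one says L1 = h.L2. *)
Definition gauge L1 (s1 : cochain2 G N) L2 (s2 : cochain2 G N) h : Prop :=
  (forall u v (x : G u v) (n : N v),
     iso_at L1 x n * c1 h x = c1 h x * iso_at L2 x n) /\
  (forall u v w (x : G u v) (y : G v w),
     c2 s1 x y * c1 h (gmul x y) = c1 h x * iso_at L2 x (c1 h y) * c2 s2 x y).

(** The dictionary (n, x) |-> (n h(x), x) between equivalences and gauge
    transformations. *)
Lemma crossed_equivP L1 L2 (s1 : factor_system L1) (s2 : factor_system L2) :
  equivalent (crossed_product s1) (crossed_product s2) <->
  exists h, gauge L1 (fs_c2 s1) L2 (fs_c2 s2) h.
Proof.
split=> [[f [fN fG]]|[h [hL hs]]].
  pose k u v (x : G u v) : N u :=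
    (ghom f ((1, x) : crossed_product s1 u v)).1.
  (* f is determined by k because (n, x) = (n, r(x)) (1, x). *)
  have fE u v (n : N u) (x : G u v) :
      ghom f ((n, x) : crossed_product s1 u v) = (n * k u v x, x).
    have -> : (n, x) =
        gmul (ext_inc (crossed_product s1) n) ((1, x) : crossed_product s1 u v).
      by rewrite /= /crossed_mul /= iso_at1 c2_unitl !mulg1 gmul1x.
    rewrite ghomM fN /k.
    have := fG _ _ ((1, x) : crossed_product s1 u v).
    case: (ghom f _) => m y /= ->.
    by rewrite /crossed_mul /= iso_at1 c2_unitl mulg1 gmul1x.
  have k1 u : k u u (gid G u) = 1.
    by rewrite /k (fN u 1).
  have fM u v w (x : G u v) (m : N v) (y : G v w) :
      iso_at L1 x m * c2 (fs_c2 s1) x y * k _ _ (gmul x y) =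
      k _ _ x * iso_at L2 x (m * k _ _ y) * c2 (fs_c2 s2) x y.
    have := ghomM f ((1, x) : crossed_product s1 u v)
      ((m, y) : crossed_product s1 v w).
    by rewrite {1}/gmul /= /crossed_mul /= !fE /= !mul1g => -[].
  (* Multiplicativity on (1, x) (m, y) contains both gauge equations: the first
     is the case y = s(x), the second the case m = 1. *)
  exists (Cochain1 k1); split=> [u v x n|u v w x y] /=.
    by have := fM _ _ _ x n (gid G v); rewrite !c2_unitr gmulx1 k1 !mulg1.
  by have := fM _ _ _ x 1 y; rewrite iso_at_1 !mul1g.
pose f u v (a : crossed_product s1 u v) : crossed_product s2 u v :=
  (a.1 * c1 h a.2, a.2).
have f1 u : f u u (gid (crossed_product s1) u) = gid (crossed_product s2) u.
  by rewrite /f /= c1_unit mulg1.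
have fM u v w (a : crossed_product s1 u v) (b : crossed_product s1 v w) :
    f u w (gmul a b) = gmul (f u v a) (f v w b).
  case: a b => [n x] [m y]; rewrite /f /= /crossed_mul /=; congr pair.
  by rewrite -!mulgA hs iso_atM !mulgA -(mulgA n) hL !mulgA.
exists (GroupoidHom f1 fM); split=> [u n|//].
by rewrite /= /f /= c1_unit mulg1.
Qed.

(** The second gauge equation can be solved for s2, and the solution inherits
    both twisted conditions from s1: multiplying them on the left by h(x)
    L2_x(h(y)), respectively h(x) L2_x(h(y)) L2_x(L2_y(h(z))), lets the gauge
    equations absorb every value of h and leaves the condition for s1. *)
Lemma gauge_transport L1 L2 (s1 : factor_system L1) h :
  (forall u v (x : G u v) (n : N v),
     iso_at L1 x n * c1 h x = c1 h x * iso_at L2 x n) ->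
  exists s2 : factor_system L2, gauge L1 (fs_c2 s1) L2 (fs_c2 s2) h.
Proof.
move=> hL.
pose t u v w (x : G u v) (y : G v w) := (c1 h x * iso_at L2 x (c1 h y))^-1 *
  (c2 (fs_c2 s1) x y * c1 h (gmul x y)).
have tr u v (x : G u v) : t u v v x (gid G v) = 1.
  by rewrite /t !c1_unit c2_unitr iso_at_1 gmulx1 mulg1 mul1g mulVg.
have tl u v (x : G u v) : t u u v (gid G u) x = 1.
  by rewrite /t !c1_unit c2_unitl iso_at1 gmul1x !mul1g mulVg.
have [s2 hs] : exists s2 : cochain2 G N, forall u v w (x : G u v) (y : G v w),
    c1 h x * iso_at L2 x (c1 h y) * c2 s2 x y =
    c2 (fs_c2 s1) x y * c1 h (gmul x y).
  by exists (Cochain2 tr tl) => *; rewrite mulVKg.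
have act : twisted_action L2 s2.
  move=> u v w x y n; apply: (mulIg (c2 s2 x y)); rewrite mulgVK.
  apply: (mulgI (c1 h x * iso_at L2 x (c1 h y))).
  have -> : c1 h x * iso_at L2 x (c1 h y) *
      (iso_at L2 x (iso_at L2 y n) * c2 s2 x y) =
      iso_at L1 x (iso_at L1 y n) *
      (c1 h x * iso_at L2 x (c1 h y) * c2 s2 x y).
    by rewrite !mulgA hL -!mulgA; congr (_ * _); rewrite !mulgA -!iso_atM hL.
  rewrite [RHS]mulgA !hs -[RHS]mulgA -hL (fs_action s1).
  by rewrite mulgA mulgVK mulgA.
have cocycle : twisted_cocycle L2 s2.
  move=> u v w r x y z.
  apply: (mulgI (c1 h x * iso_at L2 x (c1 h y * iso_at L2 y (c1 h z)))).
  transitivity (c2 (fs_c2 s1) x y * c2 (fs_c2 s1) (gmul x y) z *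
                  c1 h (gmul (gmul x y) z)).
    rewrite iso_atM act !mulgA hs !mulgVK.
    by rewrite -!mulgA -hs !mulgA.
  rewrite (fs_cocycle s1) -[_ * _ * c1 h _]mulgA -gmulA -hs.
  rewrite !mulgA hL -[c1 h x * _ * _]mulgA -iso_atM -hs.
  by rewrite [in LHS]iso_atM !mulgA.
by exists (FactorSystem act cocycle); split=> // *; rewrite hs.
Qed.

Lemma kernel_equiv_intertwiner L L1 L2 :
  kernel_equiv L L1 -> kernel_equiv L L2 ->
  exists h, forall u v (x : G u v) (n : N v),
    iso_at L1 x n * c1 h x = c1 h x * iso_at L2 x n.
Proof.
move=> [h1 L1E] [h2 L2E].
have hk u : c1 h1 (gid G u) * (c1 h2 (gid G u))^-1 = 1.
  by rewrite !c1_unit mulgV.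
exists (@Cochain1 _ _ _ (fun u v x => c1 h1 x * (c1 h2 x)^-1) hk).
move=> u v x n /=; rewrite L1E L2E.
by rewrite !mulgA !mulgVK.
Qed.

Lemma crossed_class_surj L L' (LL' : kernel_equiv L L') (c : Ext_kernel L) :
  exists s : factor_system L', c = crossed_class LL' s.
Proof.
case: c => [[C CE] cP]; have [L1 [s1 [LL1 /= Cs1]]] := cP.
have [h hL] := kernel_equiv_intertwiner LL1 LL'.
have [s s1s] := gauge_transport s1 hL; exists s.
do 2 apply: eq_exist; case: CE Cs1 {cP} => E -> Es1.
apply/ext_class_eq/(equivalent_trans Es1)/crossed_equivP; by exists h.
Qed.

(** * Twisting by central cocycles *)

Lemma H2_class_eqP L (r r' : cocycle2 L) :
  H2_class r = H2_class r' <->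
  exists k, central1 k /\ forall u v w (x : G u v) (y : G v w),
    c2 r x y = d1 L k x y * c2 r' x y.
Proof.
have eqE : H2_class r = H2_class r' <-> (r - r')%R \in coboundary2 (L := L).
  rewrite Quotient.idealrBE; split=> [rr'|/eqP//].
  exact/eqP.
have subE u v w (x : G u v) (y : G v w) :
  c2 (r - r')%R x y = c2 r x y * (c2 r' x y)^-1 by [].
rewrite eqE; split=> [/asboolP|] [k [ck kE]].
  by exists k; split=> // u v w x y; rewrite -kE subE mulgVK.
by apply/asboolP; exists k; split=> // u v w x y; rewrite subE kE mulgK.
Qed.

(** For central k, being off by the coboundary of k takes the shape of the
    second gauge equation. *)
Lemma d1_eqP L k u v w (x : G u v) (y : G v w) (a b : N u) : central1 k ->
  a = d1 L k x y * b <->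
  a * c1 k (gmul x y) = c1 k x * iso_at L x (c1 k y) * b.
Proof.
move=> ck; have <- : c1 k (gmul x y) * (d1 L k x y * b) =
    c1 k x * iso_at L x (c1 k y) * b.
  rewrite /d1 !mulgA [c1 k (gmul x y) * _]ck mulgK; congr (_ * _).
  exact: (iso_at_commute L x (ck _ _ y)).
by rewrite -ck; split=> [->|/mulgI].
Qed.

(** This gives at once independence of the action from the representative of
    the cohomology class, from the factor system and from the L' ~ L chosen to
    write down the extension: the product of the two gauge cochains works. *)
Lemma twist_equivalent L L1 L2 (LL1 : kernel_equiv L L1)
    (LL2 : kernel_equiv L L2)
    (s1 : factor_system L1) (s2 : factor_system L2) (r1 r2 : cocycle2 L) :
  equivalent (crossed_product s1) (crossed_product s2) ->
  H2_class r1 = H2_class r2 ->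
  equivalent (crossed_product (twist LL1 s1 r1))
             (crossed_product (twist LL2 s2 r2)).
Proof.
move=> /crossed_equivP[h [hL hs]] /H2_class_eqP[k [ck kr]].
have hk u : c1 h (gid G u) * c1 k (gid G u) = 1 by rewrite !c1_unit mulg1.
apply/crossed_equivP.
exists (@Cochain1 _ _ _ (fun u v x => c1 h x * c1 k x) hk).
split=> [u v x n|u v w x y] /=; first by rewrite mulgA hL -!mulgA ck.
have /(d1_eqP _ _ _ _ _ ck) {}kr := kr _ _ _ x y.
transitivity (c2 (fs_c2 s1) x y * c1 h (gmul x y) *
              (c2 r1 x y * c1 k (gmul x y))).
  by rewrite -!mulgA; congr (_ * _); rewrite !mulgA [c2 r1 x y * _]z2_central.
rewrite hs kr iso_atM (kernel_equiv_central LL2 x (ck _ _ y)).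
have cA := iso_at_commute L x (ck _ _ y).
rewrite -!mulgA; congr (_ * _); rewrite [RHS]ck -!mulgA; congr (_ * _).
rewrite [RHS]cA -!mulgA; congr (_ * _).
by rewrite [LHS]mulgA [RHS]z2_central.
Qed.

Lemma eq_crossed_class L L' (LL' : kernel_equiv L L')
    (s1 s2 : factor_system L') :
  (forall u v w (x : G u v) (y : G v w),
     c2 (fs_c2 s1) x y = c2 (fs_c2 s2) x y) ->
  crossed_class LL' s1 = crossed_class LL' s2.
Proof.
case: s1 s2 => [c a b] [c' a' b'] /= /cochain2_eq e.
by case: _ / e a' b' => a' b'; congr crossed_class; congr FactorSystem;
  apply: Prop_irrelevance.
Qed.

(** Over a single L, a gauge transformation commutes with L_x(n) for all n, and
    L_x is onto, so it is a central cochain. *)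
Lemma twist_free L (LL : kernel_equiv L L) (s : factor_system L)
    (r1 r2 : cocycle2 L) :
  equivalent (crossed_product (twist LL s r1))
             (crossed_product (twist LL s r2)) ->
  H2_class r1 = H2_class r2.
Proof.
move=> /crossed_equivP[h [hL hs]].
have ch : central1 h.
  move=> u v x n; have [g _ gK] := iso_at_bij L x.
  by rewrite /commute -[n]gK hL.
apply/H2_class_eqP; exists h; split=> // u v w x y; apply/d1_eqP => //.
apply: (mulgI (c2 (fs_c2 s) x y)); rewrite mulgA hs /=.
rewrite !mulgA; congr (_ * _).
rewrite -mulgA [RHS]mulgA -[c2 _ x y * _]ch -!mulgA; congr (_ * _).
exact: (iso_at_commute L x (ch _ _ y)).
Qed.

(** The twisting cocycle is s1^-1 s2.  It is central because s1 and s2 satisfy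
    the twisted action condition for the same L and L_xy is onto. *)
Lemma twist_transitive L (LL : kernel_equiv L L) (s1 s2 : factor_system L) :
  exists r, forall u v w (x : G u v) (y : G v w),
    c2 (fs_c2 (twist LL s1 r)) x y = c2 (fs_c2 s2) x y.
Proof.
have [r s1r] : exists r : cochain2 G N, forall u v w (x : G u v) (y : G v w),
    c2 (fs_c2 s1) x y * c2 r x y = c2 (fs_c2 s2) x y.
  exists (cochain2_mul (cochain2_inv (fs_c2 s1)) (fs_c2 s2)) => *.
  exact: mulVKg.
have cr : central2 r.
  move=> u v w x y n; have [g _ gK] := iso_at_bij L (gmul x y).
  rewrite -[n]gK; set m := iso_at L _ _.
  apply: (mulgI (c2 (fs_c2 s1) x y)); rewrite mulgA s1r.
  apply: (mulIg (c2 (fs_c2 s2) x y)^-1).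
  rewrite -(fs_action s2) (fs_action s1) -s1r invgM -!mulgA.
  by congr (_ * _); congr (_ * _); rewrite mulVKg.
have rd u v w t (x : G u v) (y : G v w) (z : G w t) : d2 L r x y z = 1.
  apply/d2_eq1 => //.
  apply: (mulgI (c2 (fs_c2 s1) x y * c2 (fs_c2 s1) (gmul x y) z)).
  transitivity (c2 (fs_c2 s2) x y * c2 (fs_c2 s2) (gmul x y) z).
    rewrite -!s1r -!mulgA; congr (_ * _); rewrite !mulgA; congr (_ * _).
    by rewrite [RHS]cr.
  rewrite (fs_cocycle s2) (fs_cocycle s1) -!s1r iso_atM.
  rewrite -!mulgA; congr (_ * _); rewrite !mulgA; congr (_ * _).
  by apply: (iso_at_commute L x) => n; apply: cr.
by exists (Cocycle2 cr rd).
Qed.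

End Extensions.

Theorem corollary3p19 (U : Type) (G : groupoid U) (N : U -> groupType)
    (L : iso_family G N) :
  outer L -> inhabited (Ext_kernel L) ->
  (forall (L' : iso_family G N) (LL' : kernel_equiv L L') (c : Ext_kernel L),
     exists sigma : factor_system L', c = crossed_class LL' sigma) /\
  exists act : H2 L -> Ext_kernel L -> Ext_kernel L,
    (forall (L' : iso_family G N) (LL' : kernel_equiv L L')
            (rho : cocycle2 L) (sigma : factor_system L'),
       act (H2_class rho) (crossed_class LL' sigma) =
       crossed_class LL' (twist LL' sigma rho)) /\
    is_action act /\
    simply_transitive act.
Proof.
move=> _ _; split; first exact: crossed_class_surj.
have LL := kernel_equiv_refl L.
have repP c := cid (crossed_class_surj LL c).
have H2_surj (a : H2 L) : exists rho, a = H2_class rho.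
  by exists (repr a); rewrite /H2_class reprK.
(* The action is defined through chosen representatives over L itself; actE
   removes the choices. *)
pose act (a : H2 L) c := crossed_class LL (twist LL (sval (repP c)) (repr a)).
have actE L' (LL' : kernel_equiv L L') (rho : cocycle2 L)
    (sigma : factor_system L') :
  act (H2_class rho) (crossed_class LL' sigma) =
  crossed_class LL' (twist LL' sigma rho).
  apply/crossed_class_eqP/twist_equivalent; last by rewrite /H2_class reprK.
  by apply/(crossed_class_eqP LL LL'); case: (repP _).
exists act; split; first exact: actE.
split; first split.
- move=> c; have [s ->] := crossed_class_surj LL c.
  have -> : 0%R = H2_class (0%R : cocycle2 L) by rewrite /H2_class GRing.raddf0.
  by rewrite actE; apply: eq_crossed_class => *; apply: mulg1.
- move=> a b c; have [s ->] := crossed_class_surj LL c.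
  have [r ->] := H2_surj a; have [r' ->] := H2_surj b.
  rewrite -[(_ + _)%R]GRing.raddfD !actE; apply: eq_crossed_class => * /=.
  by rewrite -mulgA; congr (_ * _)%g; apply: z2_central.
move=> c c'; have [s ->] := crossed_class_surj LL c.
have [s' ->] := crossed_class_surj LL c'.
have [r rE] := twist_transitive LL s s'.
exists (H2_class r); split; first by rewrite actE; apply: eq_crossed_class.
move=> b; have [r' ->] := H2_surj b; rewrite actE => /crossed_class_eqP r's'.
apply: (twist_free (LL := LL) (s := s)).
apply: equivalent_trans (equivalent_sym r's').
by apply/(crossed_class_eqP LL LL)/eq_crossed_class.
Qed.
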